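(* Let $I$ be a finite index set and let the factors $t_i$, $i\in I$, of the target density $p(x)\propto\prod_{i\in I}t_i(x)$ on $\mathbb{R}^n$ be Gaussian. Then the expectation propagation (EP) algorithm converges after updating each factor approximation once, with the limit $\tilde t_i=t_i$, $i\in I$.
   Context: EP algorithm: the target $p(x)\propto\prod_{i\in I}t_i(x)$ is approximated by $\prod_{i\in I}\tilde t_i(x)$ with Gaussian factors $\tilde t_i$. Start with arbitrary initial Gaussian distributions $\{\tilde t_i\}_{i\in I}$. Then repeatedly loop over $i\in I$, and for each $i$: (1) compute the Gaussian $\tilde q$ minimizing $D_{KL}\big(t_i\prod_{j\ne i}\tilde t_j,\tilde q\big)$ over Gaussian $\tilde q$ (products of factors being normalized to probability densities); (2) set $\tilde t_i(x)=\tilde q(x)/\prod_{j\neq i}\tilde t_j(x)$, using the current values of the other factor approximations. Here $D_{KL}(q,\tilde q)=\int q\log(q/\tilde q)\,dx$ is the Kullback--Leibler divergence, and the factors $t_i$, $\tilde t_i$ are considered up to positive multiplicative constants. Gaussian means of the form $N(x;\mu,C)$ with $C$ symmetric positive definite. Convergence after updating each factor once means that after this first sweep all further updates leave the $\tilde t_i$ unchanged. *)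

(* Defs.v *)
From HB Require Import structures.
From mathcomp Require Import all_boot all_order all_algebra.
From mathcomp Require Import all_classical all_reals all_analysis.

Set Implicit Arguments.
Unset Strict Implicit.
Unset Printing Implicit Defensive.

Import Order.TTheory GRing.Theory Num.Theory.

Local Open Scope classical_set_scope.
Local Open Scope ring_scope.

(* Points of R^n are tuples, because n.-tuple R carries the product sigma-algebra
   in MathComp-Analysis whereas 'cV[R]_n has no measurable structure. *)
Notation euclidean R n := (n.-tuple (measurableTypeR R)).

Section lebesgue_tuple.
Context {R : realType}.

Definition consp n (x : measurableTypeR R * euclidean R n) : euclidean R n.+1 :=
  [tuple of x.1 :: x.2].

Lemma measurable_consp n : measurable_fun [set: _] (@consp n).
Proof. exact: (measurable_cons measurable_fst measurable_snd). Qed.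

Section cons_measure.
Variables (n : nat) (mu : {sigma_finite_measure set (euclidean R n) -> \bar R}).

Definition cons_measure : set (euclidean R n.+1) -> \bar R :=
  pushforward (lebesgue_measure \x mu)%E (@consp n).

Let cons_measure0 : cons_measure set0 = 0%E.
Proof. by rewrite /cons_measure /pushforward preimage_set0 measure0. Qed.

Let cons_measure_ge0 A : (0 <= cons_measure A)%E.
Proof. by rewrite /cons_measure /pushforward measure_ge0. Qed.

Let cons_measure_sigma_additive : semi_sigma_additive cons_measure.
Proof. by apply: measure_semi_sigma_additive; exact: measurable_consp. Qed.

HB.instance Definition _ := isMeasure.Build _ _ _ cons_measure
  cons_measure0 cons_measure_ge0 cons_measure_sigma_additive.

Let cons_measure_sigma_finite : sigma_finite setT cons_measure.
Proof.
have /sigma_finiteP[F [FT ndF Foo]] :=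
  sigma_finiteT (@lebesgue_measure R : {sigma_finite_measure set _ -> \bar R}).
have /sigma_finiteP[G [GT ndG Goo]] := sigma_finiteT mu.
pose g (x : euclidean R n.+1) : measurableTypeR R * euclidean R n :=
  (thead x, [tuple of behead x]).
have mg : measurable_fun setT g.
  by apply: measurable_fun_pair; [exact: measurable_tnth|exact: measurable_behead].
have consK : cancel (@consp n) g.
  by case=> x y; rewrite /g /consp/=; congr pair; apply: val_inj.
exists (fun i => g @^-1` (F i `*` G i)).
  apply/esym; rewrite -subTset => x _.
  have [i _ Fi] : (\bigcup_i F i) (g x).1 by rewrite -FT.
  have [j _ Gj] : (\bigcup_i G i) (g x).2 by rewrite -GT.
  exists (maxn i j) => //; split.
  - by move: Fi; exact/subsetPset/ndF/leq_maxl.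
  - by move: Gj; exact/subsetPset/ndG/leq_maxr.
move=> i; have [mF Fi] := Foo i; have [mG Gi] := Goo i; split.
  by rewrite -[X in measurable X]setTI; apply: mg => //; exact: measurableX.
rewrite /cons_measure /pushforward -comp_preimage.
rewrite (_ : g \o @consp n = id); last by apply/funext => x /=; rewrite consK.
by rewrite preimage_id product_measure1E// lte_mul_pinfty// ge0_fin_numE.
Qed.

HB.instance Definition _ := Measure_isSigmaFinite.Build _ _ _ cons_measure
  cons_measure_sigma_finite.

End cons_measure.

Fixpoint lebesgue_tuple n : {sigma_finite_measure set (euclidean R n) -> \bar R} :=
  match n with
  | 0 => \d_([tuple] : euclidean R 0)
  | n'.+1 => cons_measure (lebesgue_tuple n')
  end.

Lemma lebesgue_tuple_box n (A : 'I_n -> set (measurableTypeR R)) :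
  (forall i, measurable (A i)) ->
  lebesgue_tuple n [set x | forall i, A i (tnth x i)] =
  (\prod_(i < n) lebesgue_measure (A i))%E.
Proof.
elim: n A => [A _|n IH A mA].
  by rewrite big_ord0 /= diracE mem_set// => -[].
rewrite big_ord_recl -IH//= -product_measure1E//; last first.
  rewrite (_ : [set x | _] =
    \bigcap_(i in [set: 'I_n]) (@tnth n (measurableTypeR R) ^~ i @^-1` A (lift ord0 i))); last first.
    by apply/seteqP; split => x /= H i; [move=> _; exact: H|exact: (H i)].
  apply: fin_bigcap_measurable => // i _.
  by rewrite -[X in measurable X]setTI; exact: measurable_tnth.
rewrite /cons_measure /pushforward /=; congr (_ _).
apply/seteqP; split => -[x y] /=.
  move=> H; split=> [|i]; first by have := H ord0.
  by have := H (lift ord0 i); rewrite tnthS.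
move=> [Hx Hy] i; case: (unliftP ord0 i) => [j ->|->//].
by rewrite tnthS; exact: Hy.
Qed.

End lebesgue_tuple.

Section gaussian.
Context {R : realType} {n : nat}.
Implicit Types (C : 'M[R]_n) (f g p q : euclidean R n -> R).

Definition posdefmx C : Prop :=
  C^T = C /\ forall v : 'cV[R]_n, v != 0 -> 0 < (v^T *m C *m v) 0 0.

Definition colvec (x : euclidean R n) : 'cV[R]_n := \col_i tnth x i.

Definition gauss_pdf (m : 'cV[R]_n) C (x : euclidean R n) : R :=
  (Num.sqrt ((2 * pi) ^+ n * \det C))^-1 *
  expR (- ((colvec x - m)^T *m invmx C *m (colvec x - m)) 0 0 / 2).

Definition gaussian_density q : Prop :=
  exists m C, posdefmx C /\ forall x, q x = gauss_pdf m C x.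

(* Equality of factors, which only matter up to a positive constant. *)
Definition proportional f g : Prop :=
  exists2 c : R, 0 < c & forall x, f x = c * g x.

Definition gaussian_factor f : Prop :=
  exists2 q, gaussian_density q & proportional f q.

Definition mass f : \bar R := (\int[lebesgue_tuple n]_x (f x)%:E)%E.

Definition normalizable f : Prop := (0 < mass f < +oo)%E.

Definition normalize f (x : euclidean R n) : R := f x / fine (mass f).

(* Since ln 0 = 0, the integrand is 0 where p vanishes, as usual. Only positive q
   occur below; a q that vanishes where p does not would need the value +oo. *)
Definition kl p q : \bar R :=
  (\int[lebesgue_tuple n]_x (p x * ln (p x / q x))%:E)%E.

Definition gaussian_kl_minimizer p q : Prop :=
  gaussian_density q /\
  forall q', gaussian_density q' -> (kl p q <= kl p q')%E.

End gaussian.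

Section expectation_propagation.
Context {R : realType} {n : nat} {I : finType}.
Implicit Types t s : I -> euclidean R n -> R.

Definition cavity s (i : I) (x : euclidean R n) : R := \prod_(j | j != i) s j x.

Definition tilted t s (i : I) (x : euclidean R n) : R := t i x * cavity s i x.

Definition ep_update t (i : I) s s' : Prop :=
  exists q, [/\ normalizable (tilted t s i),
    gaussian_kl_minimizer (normalize (tilted t s i)) q,
    proportional (s' i) (fun x => q x / cavity s i x) &
    forall j, j != i -> proportional (s' j) (s j)].

(* run m k is the family of approximations after k updates of the m-th sweep
   (both counted from 0); that sweep visits the indices in the order
   order m 0, order m 1, ..., each once when order m is a bijection. *)
Definition ep_run t (init : I -> euclidean R n -> R)
    (order : nat -> 'I_#|I| -> I)
    (run : nat -> nat -> I -> euclidean R n -> R) : Prop :=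
  [/\ forall i, proportional (run 0%N 0%N i) (init i),
      forall m (k : 'I_#|I|), ep_update t (order m k) (run m k) (run m k.+1) &
      forall m, run m.+1 0%N = run m #|I|].

Definition converges_after_first_sweep
    (run : nat -> nat -> I -> euclidean R n -> R)
    (limit : I -> euclidean R n -> R) : Prop :=
  (forall i, proportional (run 1%N 0%N i) (limit i)) /\
  forall m k, (0 < m)%N -> (k <= #|I|)%N ->
    forall i, proportional (run m k i) (run 1%N 0%N i).

End expectation_propagation.

(* Main.v *)
Require Import Defs.
From mathcomp Require Import all_boot all_order all_algebra.
From mathcomp Require Import all_classical all_reals all_analysis.
From mathcomp Require Import measurable_realfun ring lra.

(** Why the theorem holds.

    The Gaussian densities over R^n are, up to positive constants, the functions
    exp (- x^T A x / 2 + b^T x) with A symmetric positive definite, and such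
    functions are stable under products: the parameters (A, b) just add up.  Hence
    if all the t_i and all the current approximations are Gaussian, the tilted
    function t_i * \prod_(j != i) s_j is itself proportional to a Gaussian, and its
    normalization p is a Gaussian density.  So p is a candidate for its own
    Kullback-Leibler projection, and Gibbs' inequality makes it the only
    minimizer.  Dividing p by the cavity \prod_(j != i) s_j returns t_i up to a
    constant: one update replaces the i-th approximation by the exact factor,
    whatever the other approximations are ([ep_updateP]).  After a sweep that
    visits every index all the factors are exact, and any further update replaces
    an exact factor by itself.

    Two analytic facts support this.

    The mass of a Gaussian density is 1 ([mass_gaussian_density]).  The Lebesgue
    measure on R^n is built one coordinate at a time, so the integral is computed
    by induction on the dimension: completing the square in the first coordinate
    leaves the Schur complement as the quadratic form of the other coordinates
    ([qform_schur]), and the determinant splits in the same way ([det_schur]).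
    The same recursion shows that the determinant is positive.

    The Kullback-Leibler minimizer is unique ([gaussian_kl_minimizerP]).  For
    densities p, q the divergence equals the integral of
    p ln (p / q) - p + q, a nonnegative function that vanishes only where p = q
    ([integral_bregman_ln]).  A zero divergence thus gives p = q almost everywhere,
    hence everywhere for continuous functions, as every ball has positive
    measure. *)

Set Implicit Arguments.
Unset Strict Implicit.
Unset Printing Implicit Defensive.

Import Order.TTheory GRing.Theory Num.Theory.
Import numFieldNormedType.Exports.

Local Open Scope classical_set_scope.
Local Open Scope ring_scope.

(** * Positive definite matrices and Schur complements *)

Definition qform (R : realType) n (A : 'M[R]_n) (v : 'cV[R]_n) : R :=
  (v^T *m A *m v) 0 0.

Lemma qformE (R : realType) n (A : 'M[R]_n) (v : 'cV[R]_n) :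
  qform A v = \sum_(j < n) (\sum_(i < n) v i 0 * A i j) * v j 0.
Proof.
rewrite /qform mxE; apply: eq_bigr => j _; rewrite mxE; congr (_ * _).
by apply: eq_bigr => i _; rewrite mxE.
Qed.

Section positive_definite.
Context {R : realType}.

Lemma posdef_unitmx n (A : 'M[R]_n) : posdefmx A -> A \in unitmx.
Proof.
move=> [_ Apos]; rewrite -row_free_unit -kermx_eq0; apply/eqP/row_matrixP => i.
rewrite row0; apply/eqP; apply: contraT => ui0.
have := Apos (row i (kermx A))^T.
rewrite trmx_eq0 => /(_ ui0); rewrite trmxK -row_mul mulmx_ker row0 mul0mx mxE.
by rewrite ltxx.
Qed.

Lemma posdef_invmx n (A : 'M[R]_n) : posdefmx A -> posdefmx (invmx A).
Proof.
move=> Apd; have Au := posdef_unitmx Apd; case: Apd => AT Apos.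
split=> [|v v0]; first by rewrite trmx_inv AT.
have := Apos (invmx A *m v); rewrite trmx_mul trmx_inv AT -!mulmxA.
rewrite (mulKVmx Au) => -> //; apply: contraNneq v0 => iv0.
by rewrite -[v](mulKVmx Au) iv0 mulmx0.
Qed.

Lemma qformD n (A B : 'M[R]_n) v : qform (A + B) v = qform A v + qform B v.
Proof. by rewrite /qform mulmxDr mulmxDl mxE. Qed.

Lemma posdefD n (A B : 'M[R]_n) : posdefmx A -> posdefmx B -> posdefmx (A + B).
Proof.
move=> [AT A0] [BT B0]; split=> [|v v0]; first by rewrite linearD/= AT BT.
by rewrite -/(qform _ _) qformD addr_gt0 ?A0 ?B0.
Qed.

(** The expansion of the square, which exhibits the linear term [A *m m] of a
    Gaussian with mean [m] and precision [A]. *)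
Lemma qformB n (A : 'M[R]_n) (v m : 'cV[R]_n) : A^T = A ->
  qform A (v - m) = qform A v - 2 * ((A *m m)^T *m v) 0 0 + qform A m.
Proof.
move=> AT; have cross : m^T *m A *m v = (v^T *m A *m m)^T.
  by rewrite !trmx_mul trmxK AT mulmxA.
rewrite /qform trmx_mul AT [(v - m)^T]linearB/= !(mulmxBl, mulmxBr) cross !mxE.
by set x := \sum_i _; set y := \sum_i _; set z := \sum_i _; ring.
Qed.

End positive_definite.

Section schur.
Context {R : realType} {n : nat}.
Variable A : 'M[R]_(1 + n).
Hypothesis Apd : posdefmx A.

Definition pivot : R := ulsubmx A 0 0.
Definition schur : 'M[R]_n :=
  drsubmx A - pivot^-1 *: (dlsubmx A *m (dlsubmx A)^T).

Lemma pivot_gt0 : 0 < pivot.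
Proof.
set e : 'cV[R]_(1 + n) := delta_mx (lshift n 0) 0.
have e0 : e != 0.
  apply/eqP => /matrixP/(_ (lshift n 0) 0)/eqP.
  by rewrite !mxE !eqxx/= oner_eq0.
have := (proj2 Apd) e e0.
by rewrite /pivot /e trmx_delta -rowE -colE !mxE.
Qed.

Let L : 'M[R]_(1 + n) := block_mx 1%:M 0 (pivot^-1 *: dlsubmx A) 1%:M.

(** One step of block Gaussian elimination, in symmetric form: the positive pivot
    clears the first row and the first column, and leaves the Schur complement. *)
Lemma schurE : A = L *m block_mx pivot%:M 0 0 schur *m L^T.
Proof.
have AT := proj1 Apd; have p0 := lt0r_neq0 pivot_gt0.
rewrite -[LHS]submxK [ulsubmx A]mx11_scalar -[ursubmx A]trmxK trmx_ursub AT.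
rewrite /L tr_block_mx !mulmx_block !trmx1 !trmx0.
rewrite !(mul0mx, mulmx0, mul1mx, mulmx1, addr0, add0r).
rewrite -/pivot linearZ/= mul_scalar_mx scalerA mulfV// scale1r.
rewrite -scalemxAl mul_mx_scalar scalerA mulVf// scale1r.
by rewrite /schur -scalemxAr addrC subrK.
Qed.

Lemma det_schur : \det A = pivot * \det schur.
Proof.
rewrite schurE !det_mulmx det_tr det_lblock !det1 !mulr1 mul1r det_ublock.
by rewrite det_scalar1.
Qed.

(** Completing the square in the first coordinate [y]; in an integral over [y] the
    shift by a multiple of [z] is then harmless. *)
Lemma qform_schur (y : 'cV[R]_1) (z : 'cV[R]_n) :
  qform A (col_mx y z) =
  pivot * (y 0 0 + pivot^-1 * ((dlsubmx A)^T *m z) 0 0) ^+ 2 + qform schur z.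
Proof.
have -> : qform A (col_mx y z) =
    qform (block_mx pivot%:M 0 0 schur) (L^T *m col_mx y z).
  by rewrite {1}schurE /qform trmx_mul trmxK !mulmxA.
rewrite {1}/L tr_block_mx linearZ/= !trmx1 trmx0 mul_block_col !mul1mx mul0mx.
rewrite add0r.
rewrite /qform tr_col_mx mul_row_block !mulmx0 add0r addr0 mul_row_col mxE.
congr (_ + _).
rewrite -scalemxAl mul_mx_scalar -scalemxAl mxE; congr (_ * _).
by rewrite !mxE big_ord1 !mxE expr2.
Qed.

Lemma posdef_schur : posdefmx schur.
Proof.
split=> [|v v0].
  by rewrite /schur linearB/= linearZ/= trmx_mul trmxK trmx_drsub (proj1 Apd).
(* This first coordinate minimizes the form, as it cancels the square. *)
pose y : 'cV[R]_1 := (- (pivot^-1 * ((dlsubmx A)^T *m v) 0 0))%:M.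
have := (proj2 Apd) (col_mx y v); rewrite col_mx_eq0 negb_and v0 orbT.
move=> /(_ isT); rewrite -/(qform _ _) qform_schur.
by rewrite [y 0 0]mxE eqxx mulr1n addNr expr0n/= mulr0 add0r.
Qed.

End schur.

Lemma posdef_det_gt0 (R : realType) n (A : 'M[R]_n) : posdefmx A -> 0 < \det A.
Proof.
elim: n A => [A _|n IH A Apd]; first by rewrite det_mx00.
rewrite (@det_schur _ n A Apd) mulr_gt0 ?pivot_gt0//.
exact/IH/posdef_schur.
Qed.

(** * The multivariate Gaussian integral *)

Section gaussian_integral.
Context {R : realType}.

Lemma measurable_qform n (A : 'M[R]_n) (m : 'cV[R]_n) :
  measurable_fun setT (fun x : euclidean R n => qform A (colvec x - m)).
Proof.
have mc i : measurable_fun setT (fun x : euclidean R n => (colvec x - m) i 0).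
  apply: (eq_measurable_fun (fun x : euclidean R n => tnth x i - m i 0)).
    by move=> x _; rewrite !mxE.
  by apply: measurable_funB => //; exact: measurable_tnth.
under eq_fun do rewrite qformE.
apply: measurable_sum => j; apply: measurable_funM => //.
by apply: measurable_sum => i; apply: measurable_funM.
Qed.

(** The one-dimensional case, read off the total mass of the normal density with
    mean [- c] and variance [a^-1]. *)
Lemma integral_gauss1 (a c : R) : 0 < a ->
  (\int[lebesgue_measure]_y (expR (- (a * (y + c) ^+ 2) / 2))%:E =
   (Num.sqrt (2 * pi / a))%:E)%E.
Proof.
move=> a0; pose s := (Num.sqrt a)^-1.
have s0 : s != 0 by rewrite invr_eq0 gt_eqF// sqrtr_gt0.
have s2 : s ^+ 2 = a^-1 by rewrite exprVn sqr_sqrtr// ltW.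
have pk : normal_peak s = (Num.sqrt (2 * pi / a))^-1.
  by rewrite /normal_peak s2; congr (Num.sqrt _)^-1; rewrite -mulr_natl; ring.
have k0 : 0 < Num.sqrt (2 * pi / a).
  by rewrite sqrtr_gt0 divr_gt0// mulr_gt0// pi_gt0.
transitivity (\int[lebesgue_measure]_y
    ((Num.sqrt (2 * pi / a))%:E * (normal_pdf (- c) s y)%:E))%E.
  apply: eq_integral => y _.
  rewrite normal_pdfE// -EFinM pk mulVKf ?gt_eqF//.
  rewrite /normal_fun s2 opprK; congr (expR _)%:E.
  by field; rewrite gt_eqF.
rewrite ge0_integralZl//; last 2 first.
- by apply/measurable_EFinP; exact: measurable_normal_pdf.
- by move=> y _; rewrite lee_fin normal_pdf_ge0.
by rewrite integral_normal_pdf mule1.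
Qed.

Lemma measurable_expqform n (A : 'M[R]_n) (m : 'cV[R]_n) :
  measurable_fun setT
    (fun x : euclidean R n => expR (- qform A (colvec x - m) / 2)).
Proof.
apply: measurableT_comp => //; apply: measurable_funM => //.
by apply: measurableT_comp => //; exact: measurable_qform.
Qed.

Lemma colvec_consp n (y : measurableTypeR R) (z : euclidean R n)
    (m : 'cV[R]_n.+1) :
  colvec (consp (y, z)) - m =
  col_mx (y - m 0 0)%:M (colvec z - dsubmx (m : 'cV_(1 + n))) :> 'cV_(1 + n).
Proof.
rewrite -[LHS](@vsubmxK R 1 n 1); congr col_mx.
  by rewrite [LHS]mx11_scalar !mxE /=; congr (_ - m _ _)%:M; exact: val_inj.
by apply/colP => i; rewrite !mxE !(tnth_nth 0).
Qed.

(** Induction on the dimension, integrating out the first coordinate: for fixed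
    other coordinates [z] it contributes a one-dimensional Gaussian integral whose
    value is independent of [z], and what remains is the Gaussian function of the
    Schur complement. *)
Lemma integral_expqform n (A : 'M[R]_n) (m : 'cV[R]_n) : posdefmx A ->
  (\int[lebesgue_tuple n]_x (expR (- qform A (colvec x - m) / 2))%:E =
   (Num.sqrt ((2 * pi) ^+ n / \det A))%:E)%E.
Proof.
elim: n A m => [A m _|n IH A m Apd].
  rewrite det_mx00 expr0 divr1 sqrtr1 /= integral_dirac//.
    rewrite diracT mul1e /qform [(colvec _ - m)]flatmx0 mulmx0 mxE.
    by rewrite oppr0 mul0r expR0.
  by apply/measurable_EFinP; exact: measurable_expqform.
pose a := @pivot R n A; pose S := @schur R n A; pose b := @dlsubmx R 1 n 1 n A.
have a0 : 0 < a by exact: pivot_gt0.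
have Spd : posdefmx S by exact: posdef_schur.
pose m' : 'cV[R]_n := dsubmx (m : 'cV_(1 + n)).
pose f x := (expR (- qform A (colvec x - m) / 2))%:E.
have mf : measurable_fun setT f.
  by apply/measurable_EFinP; exact: measurable_expqform.
rewrite [LHS](_ : _ = \int[cons_measure (lebesgue_tuple n)]_x f x)%E//.
rewrite ge0_integral_pushforward//; last 2 first.
- exact: measurable_consp.
- by move=> x _; rewrite lee_fin expR_ge0.
rewrite preimage_setT fubini_tonelli2/=; last 2 first.
- by apply: measurableT_comp => //; exact: measurable_consp.
- by move=> x; rewrite lee_fin expR_ge0.
pose g z := (expR (- qform S (colvec z - m') / 2))%:E.
have g0 z : (0 <= g z)%E by rewrite lee_fin expR_ge0.
transitivity (\int[lebesgue_tuple n]_z ((Num.sqrt (2 * pi / a))%:E * g z))%E.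
  apply: eq_integral => z _; rewrite /fubini_G /=.
  pose c := - m 0 0 + a^-1 * (b^T *m (colvec z - m')) 0 0.
  transitivity (\int[lebesgue_measure]_y
      (g z * (expR (- (a * (y + c) ^+ 2) / 2))%:E))%E.
    apply: eq_integral => y _; rewrite /f /g -EFinM -expRD; congr (expR _)%:E.
    rewrite colvec_consp (@qform_schur R n A Apd) [_%:M 0 0]mxE eqxx mulr1n.
    by rewrite -/a -/S -/b -/m' /c; ring.
  rewrite ge0_integralZl//; last first.
    apply/measurable_EFinP/measurableT_comp => //; apply: measurable_funM => //.
    apply: measurable_funN; apply: measurable_funM => //.
    by apply: measurable_funX; apply: measurable_funD.
  by rewrite integral_gauss1// muleC.
rewrite ge0_integralZl//; last first.
  by apply/measurable_EFinP; exact: measurable_expqform.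
rewrite IH// -EFinM -sqrtrM; last first.
  by rewrite divr_ge0 ?mulr_ge0 ?pi_ge0 ?ltW.
rewrite (@det_schur R n A Apd) -/a -/S exprS; congr (Num.sqrt _)%:E.
by field; rewrite !gt_eqF ?posdef_det_gt0.
Qed.

End gaussian_integral.

(** * Gibbs' inequality and its equality case *)

Section gibbs.
Context {R : realType}.

(** The Bregman divergence of x ln x at the numbers [a] and [b]: the integrand of the
    Kullback-Leibler divergence, corrected by a term that integrates to 0 for two
    probability densities and makes it nonnegative pointwise. *)
Definition bregman_ln (a b : R) : R := a * ln (a / b) - a + b.

(** With u := ln (b / a), the divergence is [a] times the gap between the
    exponential and its tangent at 0, which is positive unless u = 0. *)
Lemma bregman_lnE (a b : R) : 0 < a -> 0 < b ->
  bregman_ln a b = a * (expR (ln (b / a)) - (1 + ln (b / a))).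
Proof.
move=> a0 b0; have ab0 : 0 < a / b by rewrite divr_gt0.
rewrite lnK ?posrE ?divr_gt0// -[b / a]invf_div lnV ?posrE// /bregman_ln.
by field; rewrite !gt_eqF.
Qed.

Lemma bregman_ln_ge0 (a b : R) : 0 < a -> 0 < b -> 0 <= bregman_ln a b.
Proof.
move=> a0 b0; rewrite bregman_lnE// (mulr_ge0 (ltW a0))// subr_ge0.
exact: expR_ge1Dx.
Qed.

Lemma bregman_ln_eq0 (a b : R) : 0 < a -> 0 < b -> bregman_ln a b = 0 -> a = b.
Proof.
move=> a0 b0; rewrite bregman_lnE// => /eqP.
rewrite mulf_eq0 gt_eqF//= subr_eq0.
have [/eqP|/expR_gt1Dx] := eqVneq (ln (b / a)) 0.
  rewrite ln_eq0 ?divr_gt0// => /eqP ba1 _.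
  by rewrite -[RHS](divfK (lt0r_neq0 a0)) ba1 mul1r.
by move=> /gt_eqF ->.
Qed.

End gibbs.

Section gibbs_integral.
Context d (T : measurableType d) (R : realType).
Variables (mu : {measure set T -> \bar R}) (p q : T -> R).
Hypotheses (mp : measurable_fun setT p) (mq : measurable_fun setT q).
Hypotheses (p0 : forall x, 0 < p x) (q0 : forall x, 0 < q x).
Hypotheses (p1 : (\int[mu]_x (p x)%:E = 1)%E) (q1 : (\int[mu]_x (q x)%:E = 1)%E).

Let h x := (p x * ln (p x / q x))%:E.

Let mh : measurable_fun setT h.
Proof.
apply/measurable_EFinP.
apply: (eq_measurable_fun (fun x => p x * (ln (p x) - ln (q x)))).
  by move=> x _; rewrite ln_div ?posrE.
apply: measurable_funM => //; apply: measurable_funB;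
  exact: measurableT_comp (@measurable_ln R) _.
Qed.

Let mg : measurable_fun setT (fun x => bregman_ln (p x) (q x)).
Proof.
by apply: measurable_funD => //; apply: measurable_funB => //;
  exact/measurable_EFinP.
Qed.

(** The integral of [h] := p ln (p / q) may be +oo, so p and q cannot simply be
    subtracted from it.  But the negative part of [h] is at most [q], hence
    integrable, and the identity h^+ + q = bregman_ln p q + p + h^- involves only
    nonnegative functions: it can be integrated term by term and the finite terms
    cancelled. *)
Lemma integral_bregman_ln :
  (\int[mu]_x (p x * ln (p x / q x))%:E =
   \int[mu]_x (bregman_ln (p x) (q x))%:E)%E.
Proof.
have g0 x : (0 <= (bregman_ln (p x) (q x))%:E)%E.
  by rewrite lee_fin bregman_ln_ge0.
have pge0 x : (0 <= (p x)%:E)%E by rewrite lee_fin ltW.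
have qge0 x : (0 <= (q x)%:E)%E by rewrite lee_fin ltW.
have mpE : measurable_fun setT (EFin \o p) by exact/measurable_EFinP.
have mqE : measurable_fun setT (EFin \o q) by exact/measurable_EFinP.
have mgE : measurable_fun setT (fun x => (bregman_ln (p x) (q x))%:E).
  exact/measurable_EFinP.
have mhp := measurable_funepos mh; have mhn := measurable_funeneg mh.
have hneg : (\int[mu]_x h^\- x)%E \is a fin_num.
  rewrite ge0_fin_numE; last exact: integral_ge0.
  apply: (@le_lt_trans _ _ 1%E); last exact: ltry.
  rewrite -q1; apply: ge0_le_integral => // x _.
  rewrite funenegE /h -EFinN -EFin_max lee_fin ge_max [0 <= q x]ltW// andbT.
  by have := bregman_ln_ge0 (p0 x) (q0 x); rewrite /bregman_ln; have := p0 x; lra.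
rewrite integralE -/h.
have : (\int[mu]_x h^\+ x + \int[mu]_x (q x)%:E =
        \int[mu]_x (bregman_ln (p x) (q x))%:E + \int[mu]_x (p x)%:E +
        \int[mu]_x h^\- x)%E.
  rewrite -!ge0_integralD//; last 2 first.
  - by move=> x _; rewrite adde_ge0.
  - exact: emeasurable_funD.
  apply: eq_integral => x _.
  rewrite funeposE funenegE /h /bregman_ln -EFinN -!EFin_max -!EFinD; congr EFin.
  by rewrite /Order.max; case: ltP => ?; case: ltP => ?; lra.
rewrite p1 q1 addeAC => /(congr1 (fun z => z - 1)%E); rewrite !addeK// => ->.
by rewrite addeK.
Qed.

(** Gibbs' inequality, which holds pointwise once the integrand is corrected. *)
Lemma integral_relative_entropy_ge0 : (0 <= \int[mu]_x h x)%E.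
Proof.
by rewrite integral_bregman_ln integral_ge0// => x _; rewrite lee_fin bregman_ln_ge0.
Qed.

(** The corrected integrand is nonnegative, so it vanishes almost everywhere when its
    integral does: this is the equality case of Gibbs' inequality. *)
Lemma integral_relative_entropy_eq0 : (\int[mu]_x h x)%E = 0%E ->
  {ae mu, forall x, p x = q x}.
Proof.
rewrite integral_bregman_ln => g0.
have : ae_eq mu setT (fun x => (bregman_ln (p x) (q x))%:E) (cst 0%E).
  apply/ae_eq_integral_abs => //; first exact/measurable_EFinP.
  rewrite -[RHS]g0; apply: eq_integral => x _.
  by rewrite gee0_abs// lee_fin bregman_ln_ge0.
apply: filterS => x /(_ I) [] /bregman_ln_eq0; exact.
Qed.

End gibbs_integral.

(** * Gaussian densities and their Kullback-Leibler projections *)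

Section gaussian_densities.
Context {R : realType} {n : nat}.
Implicit Types (C : 'M[R]_n) (m : 'cV[R]_n) (f g p q : euclidean R n -> R).

Definition gauss_norm C : R := Num.sqrt ((2 * pi) ^+ n * \det C).

Lemma gauss_norm_gt0 C : posdefmx C -> 0 < gauss_norm C.
Proof.
move=> Cpd; rewrite sqrtr_gt0 mulr_gt0 ?posdef_det_gt0// exprn_gt0//.
by rewrite mulr_gt0// pi_gt0.
Qed.

Lemma gauss_pdfE m C x : gauss_pdf m C x =
  (gauss_norm C)^-1 * expR (- qform (invmx C) (colvec x - m) / 2).
Proof. by []. Qed.

Lemma gaussian_density_gt0 q x : gaussian_density q -> 0 < q x.
Proof.
move=> [m [C [Cpd ->]]]; rewrite gauss_pdfE mulr_gt0 ?expR_gt0// invr_gt0.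
exact: gauss_norm_gt0.
Qed.

Lemma measurable_gaussian_density q : gaussian_density q -> measurable_fun setT q.
Proof.
move=> [m [C [_ qE]]]; rewrite (funext qE).
by apply: measurable_funM => //; exact: measurable_expqform.
Qed.

(** This is where the normalizing constant of [gauss_pdf] is seen to be the right
    one: the precision matrix is [invmx C], whose determinant is inverse to that of
    [C]. *)
Lemma mass_gaussian_density q : gaussian_density q -> mass q = 1%E.
Proof.
move=> [m [C [Cpd qE]]]; rewrite /mass (funext qE).
under eq_integral do rewrite gauss_pdfE EFinM.
rewrite ge0_integralZl//; last 2 first.
- by apply/measurable_EFinP; exact: measurable_expqform.
- by rewrite lee_fin invr_ge0 ltW// gauss_norm_gt0.
rewrite integral_expqform; last exact: posdef_invmx.
rewrite det_inv invrK -EFinM mulVf// gt_eqF//.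
exact: gauss_norm_gt0.
Qed.

Lemma continuous_qform (A : 'M[R]_n) m :
  continuous (fun v : 'cV[R]_n => qform A (v - m)).
Proof.
have cc i : continuous (fun v : 'cV[R]_n => (v - m) i 0).
  move=> v; rewrite (_ : (fun v => _) = (fun v : 'cV[R]_n => v i 0 - m i 0)).
    by apply: continuousB; [exact: coord_continuous|exact: cst_continuous].
  by apply/funext => w; rewrite !mxE.
under eq_fun do rewrite qformE.
apply: continuous_big => [|j _ v]; first exact: add_continuous.
apply: continuousM; last exact: cc.
move: v; apply: continuous_big => [|i _ v]; first exact: add_continuous.
by apply: continuousM; [exact: cc|exact: cst_continuous].
Qed.

Lemma continuous_gauss_pdf (c : R) m (A : 'M[R]_n) :
  continuous (fun v : 'cV[R]_n => c * expR (- qform A (v - m) / 2)).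
Proof.
move=> v.
apply: (@continuousM R _ (fun=> c)
  (fun v : 'cV[R]_n => expR (- qform A (v - m) / 2)) v); first exact: cst_continuous.
apply: (@continuous_comp _ _ _
  (fun v : 'cV[R]_n => - qform A (v - m) / 2) (@expR R)).
  apply: continuousM; last exact: cst_continuous.
  by apply: continuousN; exact: continuous_qform.
exact: continuous_expR.
Qed.

(** The balls of column vectors are those of the sup norm: they are boxes, whose
    volume is the product of the lengths of their sides. *)
Lemma colvec_ball_gt0 (x : euclidean R n) (e : R) : 0 < e ->
  measurable [set y : euclidean R n | ball (colvec x) e (colvec y)] /\
  (0 < lebesgue_tuple n [set y | ball (colvec x) e (colvec y)])%E.
Proof.
move=> e0.
have -> : [set y : euclidean R n | ball (colvec x) e (colvec y)] =
    [set y | forall i, ball (tnth x i : R) e (tnth y i)].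
  apply/seteqP; split => y /=; last first.
    by move=> xy; split=> // i j; rewrite !mxE; exact: xy.
  by move=> [_ xy] i; have := xy i 0; rewrite !mxE.
split.
  rewrite (_ : [set y | _] = \bigcap_(i in [set: 'I_n])
      (@tnth n (measurableTypeR R) ^~ i @^-1` ball (tnth x i : R) e)); last first.
    by apply/seteqP; split => y /= H i; [move=> _; exact: H|exact: (H i)].
  apply: fin_bigcap_measurable => // i _.
  rewrite -[X in measurable X]setTI; apply: measurable_tnth => //.
  exact: measurable_ball.
rewrite (@lebesgue_tuple_box _ _ (fun i => ball (tnth x i : R) e)); last first.
  by move=> i; exact: measurable_ball.
under eq_bigr do rewrite lebesgue_measure_ball ?ltW//.
rewrite prodEFin lte_fin; apply: prodr_gt0 => i _.
by rewrite mulrn_wgt0.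
Qed.

(** Two continuous functions that differ at a point differ on a ball around it, which
    is too large to be negligible.  Continuity is asked of functions of column
    vectors because these, unlike tuples, come with a topology. *)
Lemma ae_eq_continuous (F G : 'cV[R]_n -> R) : continuous F -> continuous G ->
  {ae lebesgue_tuple n, forall x, F (colvec x) = G (colvec x)} ->
  forall x, F (colvec x) = G (colvec x).
Proof.
move=> cF cG [N [mN N0 NFG]] x; apply: contrapT => /eqP FGx.
have : \forall v \near colvec x, F v - G v != 0.
  have cFG : {for colvec x, continuous (F - G)} by
    apply: continuousB; [exact: cF|exact: cG].
  apply: (cFG [set r | r != 0]); apply: open_nbhs_nbhs; split.
    exact: open_neq.
  by rewrite /= subr_eq0.
move=> /nbhs_ballP[e /= e0 eFG].
have [mB B0] := colvec_ball_gt0 x e0.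
have BN : [set y | ball (colvec x) e (colvec y)] `<=` N.
  move=> y /= /eFG /= FGy; apply: NFG => /= /eqP.
  by rewrite -subr_eq0 (negbTE FGy).
by have := le_measure (lebesgue_tuple n) (mem_set mB) (mem_set mN) BN;
  rewrite [X in (_ <= X)%E]N0 leNgt B0.
Qed.

Lemma eq_gaussian_density p q : gaussian_density p -> gaussian_density q ->
  {ae lebesgue_tuple n, forall x, p x = q x} -> p = q.
Proof.
move=> [m [C [_ pE]]] [m' [C' [_ qE]]]; rewrite (funext pE) (funext qE) => pq.
apply/funext => x.
exact: (ae_eq_continuous (@continuous_gauss_pdf _ m (invmx C))
  (@continuous_gauss_pdf _ m' (invmx C')) pq).
Qed.

(** Since [p] is itself Gaussian, the minimum of the divergence is 0, and it is
    attained at [p] only. *)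
Lemma gaussian_kl_minimizerP p q : gaussian_density p ->
  gaussian_kl_minimizer p q <-> q = p.
Proof.
move=> gp; have p0 x := gaussian_density_gt0 x gp.
have mp := measurable_gaussian_density gp; have p1 := mass_gaussian_density gp.
have klpp : kl p p = 0%E.
  by rewrite /kl integral0_eq// => x _; rewrite divff ?gt_eqF// ln1 mulr0.
have kl_ge0 q' : gaussian_density q' -> (0 <= kl p q')%E.
  move=> gq; apply: integral_relative_entropy_ge0 => //.
  - exact: measurable_gaussian_density.
  - by move=> x; exact: gaussian_density_gt0.
  - exact: mass_gaussian_density.
split=> [[gq /(_ p gp)]|->]; last by split=> // q' gq; rewrite klpp kl_ge0.
rewrite klpp => klpq.
apply/esym/eq_gaussian_density => //; apply: integral_relative_entropy_eq0 => //.
- exact: measurable_gaussian_density.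
- by move=> x; exact: gaussian_density_gt0.
- exact: mass_gaussian_density.
- by apply/eqP; rewrite eq_le klpq kl_ge0.
Qed.

End gaussian_densities.

(** * Products of Gaussian factors *)

Section gaussian_factors.
Context {R : realType} {n : nat}.
Implicit Types f g h : euclidean R n -> R.

Lemma proportional_refl f : proportional f f.
Proof. by exists 1 => // x; rewrite mul1r. Qed.

Lemma proportional_sym f g : proportional f g -> proportional g f.
Proof.
move=> [c c0 fg]; exists c^-1; first by rewrite invr_gt0.
by move=> x; rewrite fg mulKf// gt_eqF.
Qed.

Lemma proportional_trans f g h :
  proportional f g -> proportional g h -> proportional f h.
Proof.
move=> [c c0 fg] [d d0 gh]; exists (c * d); first exact: mulr_gt0.
by move=> x; rewrite fg gh mulrA.
Qed.

Lemma proportional_gaussian_factor f g :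
  proportional f g -> gaussian_factor g -> gaussian_factor f.
Proof. by move=> fg [q gq /(proportional_trans fg)]; exists q. Qed.

Lemma gaussian_factor_gt0 f x : gaussian_factor f -> 0 < f x.
Proof. by move=> [q gq [c c0 ->]]; rewrite mulr_gt0// gaussian_density_gt0. Qed.

(** A Gaussian factor in its natural parameters, the precision matrix [A] and the
    precision-weighted mean [b]: in contrast with mean and covariance, these simply
    add up when factors are multiplied. *)
Definition natural_gauss (A : 'M[R]_n) (b : 'cV[R]_n) (x : euclidean R n) : R :=
  expR (- qform A (colvec x) / 2 + (b^T *m colvec x) 0 0).

Lemma gauss_pdf_natural (m : 'cV[R]_n) C : posdefmx C ->
  proportional (gauss_pdf m C) (natural_gauss (invmx C) (invmx C *m m)).
Proof.
move=> Cpd; exists ((gauss_norm C)^-1 * expR (- qform (invmx C) m / 2)).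
  by rewrite mulr_gt0 ?expR_gt0// invr_gt0 gauss_norm_gt0.
move=> x; rewrite gauss_pdfE -mulrA -expRD qformB; last first.
  exact: (proj1 (posdef_invmx Cpd)).
by congr (_ * expR _); field.
Qed.

Lemma gaussian_factorP f : gaussian_factor f <->
  exists A b, posdefmx A /\ proportional f (natural_gauss A b).
Proof.
split=> [[q [m [C [Cpd qE]]]]|[A [b [Apd fA]]]].
  rewrite (funext qE) => fq; exists (invmx C), (invmx C *m m).
  split; first exact: posdef_invmx.
  exact: proportional_trans fq (gauss_pdf_natural m Cpd).
have Cpd := posdef_invmx Apd.
exists (gauss_pdf (invmx A *m b) (invmx A)).
  by exists (invmx A *m b), (invmx A).
apply: (proportional_trans fA); apply: proportional_sym.
have := gauss_pdf_natural (invmx A *m b) Cpd.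
by rewrite invmxK mulmxA mulmxV ?posdef_unitmx// mul1mx.
Qed.

Lemma natural_gaussM A A' b b' x :
  natural_gauss A b x * natural_gauss A' b' x =
  natural_gauss (A + A') (b + b') x.
Proof.
rewrite /natural_gauss -expRD qformD [(b + b')^T]linearD/= mulmxDl.
by rewrite [in RHS]mxE; congr expR; field.
Qed.

Lemma gaussian_factorM f g : gaussian_factor f -> gaussian_factor g ->
  gaussian_factor (fun x => f x * g x).
Proof.
move=> /gaussian_factorP[A [b [Apd [c c0 fE]]]].
move=> /gaussian_factorP[A' [b' [Apd' [c' c'0 gE]]]].
apply/gaussian_factorP; exists (A + A'), (b + b'); split; first exact: posdefD.
exists (c * c'); first exact: mulr_gt0.
by move=> x; rewrite fE gE mulrACA natural_gaussM.
Qed.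

Lemma normalize_gaussian_factor f : gaussian_factor f ->
  [/\ normalizable f, gaussian_density (normalize f) &
      proportional (normalize f) f].
Proof.
move=> [q gq [c c0 fE]].
have mf : mass f = c%:E.
  rewrite /mass (funext fE); under eq_integral do rewrite EFinM.
  rewrite ge0_integralZl ?lee_fin ?(ltW c0)//.
  - by rewrite -/(mass q) mass_gaussian_density// mule1.
  - by apply/measurable_EFinP; exact: measurable_gaussian_density.
  - by move=> x _; rewrite lee_fin ltW// gaussian_density_gt0.
have nf : normalize f = q.
  by apply/funext => x; rewrite /normalize mf fE /= mulrAC divff ?gt_eqF// mul1r.
split; first by rewrite /normalizable mf lte_fin c0 ltry.
  by rewrite nf.
by rewrite nf; apply: proportional_sym; exists c.
Qed.

End gaussian_factors.

(** * Expectation propagation *)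

Section expectation_propagation.
Context {R : realType} {n : nat} {I : finType}.
Implicit Types t s : I -> euclidean R n -> R.

(** The factor [t i] is Gaussian on its own, so the product is Gaussian even when
    the cavity is the empty product 1, which is not normalizable for n > 0. *)
Lemma gaussian_factor_tilted t s i : gaussian_factor (t i) ->
  (forall j, gaussian_factor (s j)) -> gaussian_factor (tilted t s i).
Proof.
move=> gt gs; rewrite /tilted /cavity.
elim: (index_enum _) => [|j r IH].
  by under eq_fun do rewrite big_nil mulr1.
under eq_fun do rewrite big_cons.
case: (j != i) => //; under eq_fun do rewrite mulrCA.
exact: gaussian_factorM.
Qed.

Lemma cavity_gt0 s i x : (forall j, gaussian_factor (s j)) -> 0 < cavity s i x.
Proof. by move=> gs; apply: prodr_gt0 => j _; exact: gaussian_factor_gt0. Qed.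

(** An update installs the exact factor and does nothing else.  The tilted density is
    Gaussian, so its projection is itself, and the division by the cavity undoes the
    multiplication that formed it. *)
Lemma ep_updateP t i s s' : gaussian_factor (t i) ->
  (forall j, gaussian_factor (s j)) ->
  ep_update t i s s' <->
  proportional (s' i) (t i) /\ forall j, j != i -> proportional (s' j) (s j).
Proof.
move=> gt gs.
have [ntilt gtilt ptilt] := normalize_gaussian_factor (gaussian_factor_tilted gt gs).
have recover :
    proportional (fun x => normalize (tilted t s i) x / cavity s i x) (t i).
  case: ptilt => c c0 tiltE; exists c => // x.
  by rewrite tiltE /tilted mulrA mulfK// gt_eqF// cavity_gt0.
split=> [[q [_ /(gaussian_kl_minimizerP _ gtilt) -> s'i s'j]]|[s'i s'j]].
  by split=> //; exact: proportional_trans s'i recover.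
exists (normalize (tilted t s i)); split=> //.
- exact/gaussian_kl_minimizerP.
- exact: proportional_trans s'i (proportional_sym recover).
Qed.

Section runs.
Variables (t init : I -> euclidean R n -> R) (order : nat -> 'I_#|I| -> I).
Hypotheses (gt : forall i, gaussian_factor (t i))
  (ginit : forall i, gaussian_factor (init i)).
Hypothesis order_bij : forall m, bijective (order m).

(** A run is obtained by switching each index from its initial approximation to the
    exact factor at its first visit. *)
Lemma ep_run_exists : exists run, ep_run t init order run.
Proof.
pose visited m k i :=
  (0 < m)%N || [exists k' : 'I_#|I|, (k' < k)%N && (order m k' == i)].
exists (fun m k i => if visited m k i then t i else init i).
have g m k i : gaussian_factor (if visited m k i then t i else init i).
  by case: ifP.
split=> [i|m k|m].
- rewrite /visited ltnn/=; case: existsP => [[k' //]|_].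
  exact: proportional_refl.
- apply/ep_updateP => //; split=> [|j ji].
    rewrite ifT; first exact: proportional_refl.
    by apply/orP; right; apply/existsP; exists k; rewrite leqnn eqxx.
  suff -> : visited m k.+1 j = visited m k j by exact: proportional_refl.
  congr (_ || _); apply: eq_existsb => k'; rewrite ltnS leq_eqVlt andb_orl.
  by case: eqP => [/val_inj ->|//]; rewrite eq_sym (negbTE ji).
- apply/funext => i /=; rewrite ifT//; apply/orP; right; apply/existsP.
  have [v _ vK] := order_bij m; exists (v i).
  by rewrite vK ltn_ord/=.
Qed.

Variable run : nat -> nat -> I -> euclidean R n -> R.
Hypothesis run_ep : ep_run t init order run.

(** All approximations stay Gaussian, so that [ep_updateP] applies at each step. *)
Lemma ep_run_gaussian m k i : (k <= #|I|)%N -> gaussian_factor (run m k i).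
Proof.
case: run_ep => run0 runS runE.
have sweep m' : (forall i, gaussian_factor (run m' 0 i)) ->
    forall k, (k <= #|I|)%N -> forall i, gaussian_factor (run m' k i).
  move=> g0; elim=> [//|k' IH] k'I i'.
  have gk := IH (ltnW k'I).
  have /ep_updateP[] // := runS m' (Ordinal k'I).
  move=> si sj; have [->|/sj] := eqVneq i' (order m' (Ordinal k'I)).
    exact: proportional_gaussian_factor si _.
  by move/proportional_gaussian_factor; exact.
move=> kI; apply: (sweep) => // {k kI i}.
elim: m => [i|m IH i].
  exact: proportional_gaussian_factor (run0 i) _.
by rewrite runE; exact: sweep.
Qed.

Lemma ep_run_update m (k : 'I_#|I|) i : proportional (run m k.+1 i)
  (if i == order m k then t i else run m k i).
Proof.
case: run_ep => _ runS _.
have /ep_updateP[] // := runS m k.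
  by move=> j; apply: ep_run_gaussian; exact: ltnW.
by move=> si sj; case: eqVneq => [->//|/sj].
Qed.

Lemma ep_run_visited m k (k' : 'I_#|I|) : (k <= #|I|)%N -> (k' < k)%N ->
  proportional (run m k (order m k')) (t (order m k')).
Proof.
elim: k => // k IH kI; rewrite ltnS leq_eqVlt => k'k.
apply: proportional_trans (ep_run_update m (Ordinal kI) _) _.
case: eqP => [_|neq]; first exact: proportional_refl.
apply: IH; first exact: ltnW.
by case/predU1P: k'k => // k'k; case: neq; congr order; exact: val_inj.
Qed.

Lemma ep_run_fixed m k i : (k <= #|I|)%N ->
  proportional (run m 0%N i) (t i) -> proportional (run m k i) (t i).
Proof.
move=> kI ri; elim: k kI => // k IH kI.
apply: proportional_trans (ep_run_update m (Ordinal kI) _) _.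
by case: ifP => _; [exact: proportional_refl|exact/IH/ltnW].
Qed.

Lemma ep_run_converges : converges_after_first_sweep run t.
Proof.
have limit m i : proportional (run m.+1 0%N i) (t i).
  case: run_ep => _ _ ->; have [v _ vK] := order_bij m.
  by rewrite -[i]vK; exact: ep_run_visited.
split=> [i|[//|m] k _ kI i]; first exact: limit.
apply: proportional_trans (ep_run_fixed kI (limit m i)) _.
exact/proportional_sym/limit.
Qed.

End runs.

End expectation_propagation.

Theorem proposition2p1 (R : realType) (n : nat) (I : finType)
    (t init : I -> euclidean R n -> R) (order : nat -> 'I_#|I| -> I) :
  (forall i, gaussian_factor (t i)) ->
  (forall i, gaussian_factor (init i)) ->
  (forall m, bijective (order m)) ->
  (exists run, ep_run t init order run) /\
  (forall run, ep_run t init order run -> converges_after_first_sweep run t).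
Proof.
move=> gt ginit order_bij; split; first exact: ep_run_exists.
by move=> run run_ep; exact: ep_run_converges run_ep.
Qed.
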